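(* Let $N\ge0$ and consider the discrete symplectic system $y_{k+1}=\mathcal S_k y_k$, $k=0,\dots,N$, with $\mathcal S_k\in Sp(2n)$. For every symplectic fundamental matrix $\mathcal Z_k\in Sp(2n)$, $k=0,\dots,N+1$, of this system (i.e. $\mathcal Z_{k+1}=\mathcal S_k\mathcal Z_k$), writing $\mathbf b=(0\;\,I)^T$, $$\mu_c^{-}(\mathcal Z_0^{-1}\mathbf b,\mathcal Z_1^{-1}\mathbf b,\dots,\mathcal Z_{N+1}^{-1}\mathbf b)=l^*(\mathcal Y^{[0]},0,N+1)=\mu_c^{+}(\mathcal Z_{N+1}^{-1}\mathbf b,\mathcal Z_N^{-1}\mathbf b,\dots,\mathcal Z_0^{-1}\mathbf b)=l(\mathcal Y^{[N+1]},0,N+1),$$ $$\nu_c^{-}(\mathcal Z_0^{-1}\mathbf b,\mathcal Z_1^{-1}\mathbf b,\dots,\mathcal Z_{N+1}^{-1}\mathbf b)=l^*(\mathcal Y^{[N+1]},0,N+1)=\nu_c^{+}(\mathcal Z_{N+1}^{-1}\mathbf b,\mathcal Z_N^{-1}\mathbf b,\dots,\mathcal Z_0^{-1}\mathbf b)=l(\mathcal Y^{[0]},0,N+1).$$ In particular, these cyclic sums do not depend on the choice of the symplectic fundamental matrix $\mathcal Z_k$.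
   Context: $\mathcal{J}=\begin{pmatrix}0&I\\-I&0\end{pmatrix}\in\mathbb{R}^{2n\times 2n}$, $w(Y,\hat Y)=Y^T\mathcal{J}\hat Y$, $Sp(2n)=\{Z\in\mathbb{R}^{2n\times2n}: Z^T\mathcal{J}Z=\mathcal{J}\}$; $\mathbf b=(0\;\,I)^T$ is the $2n\times n$ matrix with upper block $0$ and lower block $I$. For a real symmetric matrix $A$, $\operatorname{ind}A$ is the number of negative eigenvalues counted with multiplicity. $A^{\dagger}$ is the Moore–Penrose pseudoinverse. A frame is a real $2n\times n$ matrix $Y$ with $w(Y,Y)=0$ and $\operatorname{rank}Y=n$. For frames $Y=\binom{X}{U}$, $\hat Y=\binom{\hat X}{\hat U}$ ($n\times n$ blocks) put $\mathcal M=(I-X^{\dagger}X)\,w(Y,\hat Y)$, $\mathcal T=I-\mathcal M^{\dagger}\mathcal M$, $\mathcal P=\mathcal T\,w(Y,\hat Y)^T X^{\dagger}\hat X\,\mathcal T$ (symmetric), and define the comparative index and dual comparative index $\mu(Y,\hat Y)=\operatorname{rank}\mathcal M+\operatorname{ind}\mathcal P$, $\mu^*(Y,\hat Y)=\operatorname{rank}\mathcal M+\operatorname{ind}(-\mathcal P)$. Cyclic sums, $m\ge2$: $\mu_c^-(Y_1,\dots,Y_m)=\sum_{k=1}^{m-1}\mu(Y_k,Y_{k+1})+\mu(Y_m,Y_1)$, $\mu_c^+(Y_1,\dots,Y_m)=\sum_{k=1}^{m-1}\mu^*(Y_k,Y_{k+1})+\mu^*(Y_m,Y_1)$, $\nu_c^-(Y_1,\dots,Y_m)=\sum_{k=1}^{m-1}\mu(Y_k,Y_{k+1})-\mu(Y_1,Y_m)$,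 $\nu_c^+(Y_1,\dots,Y_m)=\sum_{k=1}^{m-1}\mu^*(Y_k,Y_{k+1})-\mu^*(Y_1,Y_m)$. A conjoined basis of the system is a sequence of frames $\mathcal Y_k$, $k=0,\dots,N+1$, with $\mathcal Y_{k+1}=\mathcal S_k\mathcal Y_k$. The principal solution $\mathcal Y^{[M]}$ at $M\in\{0,\dots,N+1\}$ is the conjoined basis with $\mathcal Y^{[M]}_M=\mathbf b$. The total numbers of forward and backward focal points of a conjoined basis $\mathcal Y$ are $l(\mathcal Y,0,N+1)=\sum_{k=0}^N\mu(\mathcal Y_{k+1},\mathcal S_k\mathbf b)$ and $l^*(\mathcal Y,0,N+1)=\sum_{k=0}^N\mu^*(\mathcal Y_k,\mathcal S_k^{-1}\mathbf b)$. (Known: for $\mathcal Y_k=\mathcal Z_k\mathbf b$ with $\mathcal Z_k$ a symplectic fundamental matrix, the $k$-th summands equal $\mu^*(\mathcal Z_{k+1}^{-1}\mathbf b,\mathcal Z_k^{-1}\mathbf b)$ and $\mu(\mathcal Z_k^{-1}\mathbf b,\mathcal Z_{k+1}^{-1}\mathbf b)$, respectively.) *)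

(* Defs.v *)
From mathcomp Require Import all_boot all_order all_algebra.
From mathcomp Require Import polyrcf.

Set Implicit Arguments.
Unset Strict Implicit.
Unset Printing Implicit Defensive.

Import Order.TTheory GRing.Theory Num.Theory.
Local Open Scope ring_scope.

Section MoorePenrose.
Variable R : realFieldType.

Definition penrose m n (A : 'M[R]_(m, n)) (G : 'M[R]_(n, m)) : bool :=
  [&& A *m G *m A == A, G *m A *m G == G,
      (A *m G)^T == A *m G & (G *m A)^T == G *m A].

Lemma mulmx_tr_eq0 m n (A : 'M[R]_(m, n)) : A *m A^T = 0 -> A = 0.
Proof.
move=> /matrixP AA; apply/matrixP => i j; move: (AA i i).
rewrite !mxE => /eqP; under eq_bigr do rewrite mxE -expr2.
rewrite psumr_eq0; last by move=> k _; rewrite sqr_ge0.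
by move=> /allP/(_ j); rewrite mem_index_enum sqrf_eq0 => /(_ isT)/eqP.
Qed.

Lemma gram_unit m n (A : 'M[R]_(m, n)) : row_free A -> A *m A^T \in unitmx.
Proof.
move=> fA; rewrite -row_free_unit; apply/inj_row_free => v vAA.
have /mulmx_tr_eq0 vA : v *m A *m (v *m A)^T = 0.
  by rewrite trmx_mul !mulmxA -(mulmxA v) vAA mul0mx.
by apply: (row_free_inj fA); rewrite mul0mx.
Qed.

Lemma penrose_exists m n (A : 'M[R]_(m, n)) : exists G, penrose A G.
Proof.
move: (col_base A) (row_base A) (mulmx_base A) (col_base_full A) (row_base_free A).
move: (\rank A) => r B C /esym AE Bfull Cfree; have CU := gram_unit Cfree.
have BU : B^T *m B \in unitmx.
  by have := @gram_unit _ _ B^T; rewrite trmxK; apply; rewrite /row_free mxrank_tr.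
have [H CH HC] : exists2 H, C *m H = 1%:M & (H *m C)^T = H *m C.
  exists (C^T *m invmx (C *m C^T)); first by rewrite mulmxA mulmxV.
  by rewrite !trmx_mul trmx_inv !trmx_mul !trmxK mulmxA.
have [K KB BK] : exists2 K, K *m B = 1%:M & (B *m K)^T = B *m K.
  exists (invmx (B^T *m B) *m B^T); first by rewrite -mulmxA mulVmx.
  by rewrite !trmx_mul trmx_inv !trmx_mul !trmxK mulmxA.
have AG : A *m (H *m K) = B *m K.
  by rewrite [in LHS]AE -!mulmxA (mulmxA C) CH mul1mx.
have GA : H *m K *m A = H *m C.
  by rewrite [in LHS]AE -!mulmxA (mulmxA K) KB mul1mx.
exists (H *m K); apply/and4P; split; apply/eqP; rewrite ?AG ?GA //.
  by rewrite [in LHS]AE -!mulmxA (mulmxA K) KB mul1mx.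
by rewrite -!mulmxA (mulmxA C) CH mul1mx.
Qed.

Lemma penrose_uniq m n (A : 'M[R]_(m, n)) G1 G2 :
  penrose A G1 -> penrose A G2 -> G1 = G2.
Proof.
move=> /and4P[/eqP a1 /eqP b1 /eqP c1 /eqP d1].
move=> /and4P[/eqP a2 /eqP b2 /eqP c2 /eqP d2].
have eL : A *m G1 = A *m G2.
  rewrite -c1 -{1}a2 -[A *m G2 *m A *m G1]mulmxA trmx_mul c1 c2.
  by rewrite mulmxA a1.
have eR : G1 *m A = G2 *m A.
  rewrite -d1 -{1}a2 -[A *m G2 *m A]mulmxA mulmxA trmx_mul d1 d2.
  by rewrite -mulmxA [A *m (_ *m _)]mulmxA a1.
by rewrite -b1 -b2 eR -mulmxA eL mulmxA.
Qed.

Definition mpinv m n (A : 'M[R]_(m, n)) : 'M[R]_(n, m) :=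
  xchoose (penrose_exists A).

Lemma mpinvP m n (A : 'M[R]_(m, n)) : penrose A (mpinv A).
Proof. exact: xchooseP. Qed.

End MoorePenrose.

Section ComparativeIndex.
Variables (R : rcfType) (n : nat).
Implicit Types (Y Yh : 'M[R]_(n + n, n)) (Z : 'M[R]_(n + n)).

(* negative eigenvalues of a symmetric matrix, counted as roots of its
   characteristic polynomial (rootsR lists the distinct real roots) *)
Definition ind p (A : 'M[R]_p) : nat :=
  (\sum_(x <- rootsR (char_poly A) | (x < 0)%R) mup x (char_poly A))%N.

Definition Jmx : 'M[R]_(n + n) := block_mx 0 1%:M (- 1%:M) 0.

Definition symplectic Z : Prop := Z^T *m Jmx *m Z = Jmx.

Definition wronskian Y Yh : 'M[R]_n := Y^T *m Jmx *m Yh.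

Definition frame Y : Prop := wronskian Y Y = 0 /\ \rank Y = n.

Definition bmx : 'M[R]_(n + n, n) := col_mx 0 1%:M.

Definition ci_M Y Yh : 'M[R]_n :=
  (1%:M - mpinv (usubmx Y) *m usubmx Y) *m wronskian Y Yh.

Definition ci_T Y Yh : 'M[R]_n := 1%:M - mpinv (ci_M Y Yh) *m ci_M Y Yh.

Definition ci_P Y Yh : 'M[R]_n :=
  ci_T Y Yh *m (wronskian Y Yh)^T *m mpinv (usubmx Y) *m usubmx Yh *m ci_T Y Yh.

Definition comp_index Y Yh : nat := (\rank (ci_M Y Yh) + ind (ci_P Y Yh))%N.

Definition dual_comp_index Y Yh : nat :=
  (\rank (ci_M Y Yh) + ind (- ci_P Y Yh))%N.

(* The cyclic sums of the m-tuple Y 1, ..., Y m, for m >= 2; the other values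
   of Y are not used. *)
Definition mu_c_minus (m : nat) (Y : nat -> 'M[R]_(n + n, n)) : nat :=
  (\sum_(1 <= k < m) comp_index (Y k) (Y k.+1) + comp_index (Y m) (Y 1))%N.

Definition mu_c_plus (m : nat) (Y : nat -> 'M[R]_(n + n, n)) : nat :=
  (\sum_(1 <= k < m) dual_comp_index (Y k) (Y k.+1)
   + dual_comp_index (Y m) (Y 1))%N.

Definition nu_c_minus (m : nat) (Y : nat -> 'M[R]_(n + n, n)) : int :=
  (\sum_(1 <= k < m) comp_index (Y k) (Y k.+1))%N%:Z
  - (comp_index (Y 1%N) (Y m))%:Z.

Definition nu_c_plus (m : nat) (Y : nat -> 'M[R]_(n + n, n)) : int :=
  (\sum_(1 <= k < m) dual_comp_index (Y k) (Y k.+1))%N%:Z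
  - (dual_comp_index (Y 1%N) (Y m))%:Z.

(* The system y_(k+1) = S k *m y_k, 0 <= k <= N: only S 0, ..., S N and
   the values at 0, ..., N.+1 of its solutions are constrained. *)
Section System.
Variables (N : nat) (S : nat -> 'M[R]_(n + n)).

Definition symplectic_system : Prop :=
  forall k, (k <= N)%N -> symplectic (S k).

Definition fundamental_matrix (Z : nat -> 'M[R]_(n + n)) : Prop :=
  (forall k, (k <= N.+1)%N -> symplectic (Z k)) /\
  (forall k, (k <= N)%N -> Z k.+1 = S k *m Z k).

Definition conjoined_basis (Y : nat -> 'M[R]_(n + n, n)) : Prop :=
  (forall k, (k <= N.+1)%N -> frame (Y k)) /\
  (forall k, (k <= N)%N -> Y k.+1 = S k *m Y k).

Definition principal_solution (M : nat) (Y : nat -> 'M[R]_(n + n, n)) : Prop :=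
  conjoined_basis Y /\ Y M = bmx.

Definition forward_focal (Y : nat -> 'M[R]_(n + n, n)) : nat :=
  (\sum_(0 <= k < N.+1) comp_index (Y k.+1) (S k *m bmx))%N.

Definition backward_focal (Y : nat -> 'M[R]_(n + n, n)) : nat :=
  (\sum_(0 <= k < N.+1) dual_comp_index (Y k) (invmx (S k) *m bmx))%N.

End System.

Lemma Jmx_unit : Jmx \in unitmx.
Proof.
have JJ : Jmx *m (- Jmx) = 1%:M.
  rewrite mulmxN /Jmx mulmx_block !mulmx0 !mul0mx !mulmxN !mulmx1.
  rewrite !addr0 sub0r opp_block_mx !opprK oppr0.
  by rewrite -scalar_mx_block.
by have [] := mulmx1_unit JJ.
Qed.

Lemma symplectic_unit Z : symplectic Z -> Z \in unitmx.
Proof.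
move=> /(congr1 (fun A => A \in unitmx)).
by rewrite Jmx_unit !unitmx_mul => /andP[].
Qed.

Lemma symplectic_inv Z : symplectic Z -> symplectic (invmx Z).
Proof.
move=> sZ; have uZ := symplectic_unit sZ.
rewrite /symplectic -{1}sZ !mulmxA -trmx_mul mulmxV // trmx1 mul1mx.
by rewrite -mulmxA mulmxV // mulmx1.
Qed.

Lemma symplectic_mul Z1 Z2 :
  symplectic Z1 -> symplectic Z2 -> symplectic (Z1 *m Z2).
Proof.
move=> s1 s2; rewrite /symplectic trmx_mul -!mulmxA (mulmxA Z1^T).
by rewrite (mulmxA (Z1^T *m _)) s1 mulmxA s2.
Qed.

Lemma symplectic_frame Z : symplectic Z -> frame (Z *m bmx).
Proof.
move=> sZ; split.
  rewrite /wronskian trmx_mul -!mulmxA (mulmxA Z^T) (mulmxA (Z^T *m _)) sZ.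
  rewrite /Jmx /bmx tr_col_mx trmx0 trmx1 mul_block_col mul_row_col.
  by rewrite !(mulmx0, mul0mx, mulmx1, addr0, add0r).
rewrite -mxrank_tr trmx_mul mxrankMfree; last first.
  by rewrite row_free_unit unitmx_tr symplectic_unit.
by rewrite mxrank_tr rank_col_0mx mxrank1.
Qed.

Lemma principal_solution_exists N S (Z : nat -> 'M[R]_(n + n)) M :
  fundamental_matrix N S Z -> (M <= N.+1)%N ->
  principal_solution N S M (fun k => Z k *m invmx (Z M) *m bmx).
Proof.
move=> [sZ eZ] leM; have sM := sZ _ leM; split; last first.
  by rewrite mulmxV ?mul1mx ?symplectic_unit.
split=> k lek; last by rewrite eZ // -!mulmxA.
by apply/symplectic_frame/symplectic_mul/symplectic_inv => //; exact: sZ.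
Qed.

End ComparativeIndex.

(* Main.v *)
Require Import Defs.
From mathcomp Require Import all_boot all_order all_algebra.
From mathcomp Require Import polyrcf complex reals zify ring.
Set Implicit Arguments.
Unset Strict Implicit.
Unset Printing Implicit Defensive.
Import Order.TTheory GRing.Theory Num.Theory.
Local Open Scope ring_scope.

(** Choose a Lagrangian plane transverse to all the planes V_k = Z_k^-1 b and
    to b: in suitable coordinates V_k is then the graph of a symmetric matrix
    a_k, and b that of 0. Haynsworth's inertia formula for a block matrix with
    a singular corner gives
      mu(Y, Yh) = ind (A_Y - A_Yh) + ind (A_Yh - A_b) - ind (A_Y - A_b),
    where b may be moved to any reference plane by a symplectic matrix; mu^* is
    the same with all the signs inside ind reversed. Hence each of the sums in
    the theorem telescopes to
      sum_k ind (a_k - a_(k+1)) + ind (a_(N+1) - a_0)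
    or to
      sum_k ind (a_k - a_(k+1)) - ind (a_0 - a_(N+1)). *)

(** * Negative eigenvalues of real symmetric matrices: spectral decomposition and congruence *)

Section Inertia.
Local Open Scope sesquilinear_scope.
Variable R : rcfType.

Lemma rank_diag_mx (F : fieldType) p (d : 'rV[F]_p) :
  \rank (diag_mx d) = #|[pred i | d 0 i != 0]|.
Proof.
elim: p d => [|p IHp] d.
  by rewrite flatmx0 mxrank0 eq_card0 // => -[].
rewrite -[p.+1]/(1 + p)%N in d *; rewrite -[d]hsubmxK diag_mx_row rank_diag_block_mx IHp.
rewrite -!sum1_card big_mkcond [RHS]big_mkcond (@big_split_ord _ _ _ 1%N p) /=.
rewrite big_ord1 inE row_mxEl; congr (_ + _)%N; last first.
  by apply: eq_bigr => i _; rewrite !inE row_mxEr.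
rewrite rank_rV -[RHS]/(nat_of_bool (lsubmx d 0 ord0 != 0)).
congr (nat_of_bool (~~ _)); apply/eqP/eqP => [/matrixP/(_ 0 0)|d0].
  by rewrite !mxE eqxx.
by apply/matrixP => i j; rewrite !ord1 mxE d0 mul0rn mxE.
Qed.

(** [ind] adds multiplicities over the distinct negative roots, and each multiplicity is a number of
    occurrences in [s]; exchanging the two sums counts every negative entry of [s] once. *)
Lemma ind_prod_XsubC p (A : 'M[R]_p) (s : seq R) :
  char_poly A = \prod_(x <- s) ('X - x%:P) -> ind A = count (< 0) s.
Proof.
move=> E; rewrite /ind E -big_filter.
have P0 : \prod_(x <- s) ('X - x%:P) != 0 :> {poly R}.
  by rewrite monic_neq0 // monic_prod_XsubC.
set r := rootsR _; under eq_bigr do rewrite mu_prod_XsubC.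
have ur : uniq [seq x <- r | x < 0] by rewrite filter_uniq // uniq_roots.
have memr x : (x \in r) = (x \in s).
  by rewrite -roots_on_rootsR //= root_prod_XsubC.
under eq_bigr do rewrite -sum1_count big_mkcond /=.
rewrite exchange_big -sum1_count [RHS]big_mkcond /= big_seq [RHS]big_seq.
apply: eq_bigr => x xs; rewrite -big_mkcond /= sum1_count.
under eq_count do rewrite eq_sym.
by rewrite (count_uniq_mem x ur) mem_filter memr xs andbT; case: (x < 0).
Qed.

(** The eigenvalues stay in [R], but the eigenvectors (the rows of [P], acting from the left) are
    taken in [R[i]], where the spectral theorem for hermitian matrices applies. *)
Definition spectral_decomp p (A : 'M[R]_p) (d : 'rV[R]_p) (P : 'M[R[i]]_p) :=
  P \is unitarymx /\
  map_mx (real_complex R) A = P^t* *m map_mx (real_complex R) (diag_mx d) *m P.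

Lemma spectral_decomp_exists p (A : 'M[R]_p) :
  A^T = A -> exists d P, spectral_decomp A d P.
Proof.
move=> sA; pose AC := map_mx (real_complex R) A.
have hA : AC \is hermsymmx.
  apply: realsym_hermsym.
    by apply/is_hermitianmxP; rewrite expr0 scale1r map_mx_id // map_trmx sA.
  by apply/mxOverP => i j; rewrite mxE; apply/complex_realP; exists (A i j).
have /hermitian_normalmx/orthomx_spectralP := hA.
set P := spectralmx _; set sp := spectral_diag _ => EA.
have spR := hermitian_spectral_diag_real hA.
(* A hermitian matrix has real spectrum, so taking real parts loses nothing. *)
pose d : 'rV[R]_p := map_mx (@complex.Re R) sp.
have dE : sp = map_mx (real_complex R) d.
  apply/rowP => i; rewrite !mxE; apply/esym/RRe_real.
  by have /mxOverP := spR; apply.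
have unP : P \is unitarymx by apply: spectral_unitarymx.
exists d, P; split=> //; rewrite map_diag_mx -dE -(invmx_unitary unP).
exact: EA.
Qed.

Lemma char_poly_spectral_decomp p (A : 'M[R]_p) d P : spectral_decomp A d P ->
  char_poly A = \prod_(x <- codom (d 0)) ('X - x%:P).
Proof.
move=> [unP EA]; have uP := unitarymx_unit unP.
apply: (@map_poly_inj _ _ (real_complex R)).
rewrite map_char_poly EA -invmx_unitary // map_diag_mx.
set sp := map_mx _ d; rewrite /char_poly /char_poly_mx.
have ->: 'X%:M - map_mx polyC (invmx P *m diag_mx sp *m P) =
   map_mx polyC (invmx P) *m (char_poly_mx (diag_mx sp)) *m map_mx polyC P.
  rewrite mulmxBr mulmxBl -!map_mxM /= mul_mx_scalar -scalemxAl -map_mxM.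
  by rewrite mulVmx // map_mx1 scalemx1.
rewrite !det_mulmx mulrAC -det_mulmx -map_mxM mulVmx //.
rewrite map_mx1 det1 mul1r -[LHS]/(char_poly _).
rewrite char_poly_trig ?diag_mx_is_trig // rmorph_prod big_map big_enum /=.
by apply: eq_bigr => i _; rewrite !mxE eqxx mulr1n rmorphB /= map_polyX map_polyC.
Qed.

Lemma ind_spectral_decomp p (A : 'M[R]_p) d P : spectral_decomp A d P ->
  ind A = #|[pred i | d 0 i < 0]|.
Proof.
move=> /char_poly_spectral_decomp/ind_prod_XsubC ->.
by rewrite count_map -size_filter cardE enumT.
Qed.

Lemma rank_spectral_decomp p (A : 'M[R]_p) d P : spectral_decomp A d P ->
  \rank A = #|[pred i | d 0 i != 0]|.
Proof.
move=> [unP EA]; have uP := unitarymx_unit unP.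
rewrite -rank_diag_mx -(mxrank_map (real_complex R)) EA mxrankMfree.
  rewrite -mxrank_tr trmx_mul mxrankMfree; first by rewrite mxrank_tr mxrank_map.
  by rewrite row_free_unit unitmx_tr -invmx_unitary // unitmx_inv.
by rewrite row_free_unit.
Qed.

Lemma spectral_decompN p (A : 'M[R]_p) d P :
  spectral_decomp A d P -> spectral_decomp (- A) (- d) P.
Proof.
move=> [unP EA]; split; first exact: unP.
by rewrite [diag_mx _]linearN /= !map_mxN EA mulmxN mulNmx.
Qed.

(** [- A] has the opposite eigenvalues in the same eigenbasis, so the two indices together count the
    nonzero eigenvalues. *)
Lemma ind_add_indN p (A : 'M[R]_p) : A^T = A -> (ind A + ind (- A) = \rank A)%N.
Proof.
move=> /spectral_decomp_exists[d [P dP]].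
rewrite (rank_spectral_decomp dP) (ind_spectral_decomp dP).
rewrite (ind_spectral_decomp (spectral_decompN dP)).
rewrite -[RHS](cardID [pred i | d 0 i < 0]); congr (_ + _)%N.
  by apply: eq_card => i; rewrite !inE; case: ltgtP.
by apply: eq_card => i; rewrite !inE mxE oppr_lt0; case: ltgtP.
Qed.

Lemma ind0 p : ind (0 : 'M[R]_p) = 0%N.
Proof. by have := @ind_add_indN p 0 (trmx0 _ _ _); rewrite mxrank0; case: ind. Qed.

Lemma quad_diagE p (v : 'rV[R[i]]_p) (d : 'rV[R]_p) :
  (v *m map_mx (real_complex R) (diag_mx d) *m v^t*) 0 0 =
  \sum_i real_complex R (d 0 i) * `|v 0 i| ^+ 2.
Proof.
rewrite map_diag_mx mul_mx_diag mxE; apply: eq_bigr => i _.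
by rewrite !mxE normCK mulrAC mulrC.
Qed.

(* A combination of the negative eigenvectors of C A C^T that is orthogonal to
   the negative eigenvectors of A vanishes. *)
Lemma ind_congr_le p q (A : 'M[R]_p) (C : 'M[R]_(q, p)) :
  A^T = A -> (ind (C *m A *m C^T) <= ind A)%N.
Proof.
move=> sA.
have sB : (C *m A *m C^T)^T = C *m A *m C^T.
  by rewrite !trmx_mul trmxK sA mulmxA.
have [d [P dP]] := spectral_decomp_exists sA.
have [e [Q eQ]] := spectral_decomp_exists sB.
rewrite (ind_spectral_decomp dP) (ind_spectral_decomp eQ) leqNgt.
(* [diag_mx (neg r x)] projects onto the coordinates where [x] is negative; its rank is the index to
   be compared. *)
pose neg r (x : 'rV[R]_r) : 'rV[R[i]]_r := \row_i (x 0 i < 0)%R%:R.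
have rk r x : \rank (diag_mx (neg r x)) = #|[pred i | x 0 i < 0]|.
  rewrite rank_diag_mx; apply: eq_card => i; rewrite !inE !mxE.
  by rewrite pnatr_eq0 eqb0 negbK.
rewrite -!rk; apply/negP => lt_rk.
(* [K] is [C] written in the two eigenbases; [EK] is then the congruence between the diagonal
   forms. *)
pose K := Q *m map_mx (real_complex R) C *m P^t*.
have [unP EA] := dP; have [unQ EB] := eQ.
have QQ : Q *m Q^t* = 1%:M by apply/unitarymxP.
have EK : K *m map_mx (real_complex R) (diag_mx d) *m K^t* = map_mx (real_complex R) (diag_mx e).
  have -> : K^t* = P *m map_mx (real_complex R) C^T *m Q^t*.
    have -> : map_mx (real_complex R) C^T = (map_mx (real_complex R) C)^t*.
      apply/matrixP => i j; rewrite !mxE conj_Creal //.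
      by apply/complex_realP; exists (C j i).
    have {1}-> : P = (P^t*)^t* by apply/matrixP => i j; rewrite !mxE conjCK.
    by rewrite /K !trmx_mul !map_mxM mulmxA.
  transitivity (Q *m map_mx (real_complex R) (C *m A *m C^T) *m Q^t*).
    by rewrite !map_mxM [map_mx (real_complex R) A]EA /K !mulmxA.
  by rewrite EB !mulmxA QQ mul1mx -mulmxA QQ mulmx1.
clearbody K.
(* By the rank count, some nonzero vector supported on the negative coordinates of [e] is sent by
   [K] to one that vanishes on those of [d]. *)
have : (diag_mx (neg q e) :&: kermx (K *m diag_mx (neg p d)) != 0)%MS.
  rewrite -mxrank_eq0 -lt0n.
  have := mxrank_mul_ker (diag_mx (neg q e)) (K *m diag_mx (neg p d)).
  have : (\rank (diag_mx (neg q e) *m (K *m diag_mx (neg p d))) <=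
          \rank (diag_mx (neg p d)))%N.
    by rewrite mulmxA mxrankM_maxr.
  move=> le_rk rkE; rewrite lt0n; apply/eqP => cap0.
  by have := leq_ltn_trans le_rk lt_rk; rewrite -rkE cap0 addn0 ltnn.
case/rowV0Pn => v; rewrite sub_capmx => /andP[/submxP[u vE] /sub_kermxP vK] v0.
have v_eq0 i : ~~ (e 0 i < 0) -> v 0 i = 0.
  by move=> /negbTE ei; rewrite vE mul_mx_diag !mxE ei mulr0.
have w_eq0 i : d 0 i < 0 -> (v *m K) 0 i = 0.
  move: vK; rewrite mulmxA => /rowP/(_ i).
  by rewrite mul_mx_diag !mxE => + di; rewrite di mulr1.
(* Evaluated through [d] the form is nonnegative; evaluated through [e] all its terms are
   nonpositive, so each of them vanishes. *)
have : 0 <= (v *m map_mx (real_complex R) (diag_mx e) *m v^t*) 0 0.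
  have vKt : (v *m K)^t* = K^t* *m v^t* by rewrite trmx_mul map_mxM.
  rewrite -EK !mulmxA -mulmxA -vKt quad_diagE sumr_ge0 // => i _.
  have [/w_eq0 ->|di] := ltP (d 0 i) 0; first by rewrite normr0 expr0n mulr0.
  by rewrite mulr_ge0 ?exprn_ge0 // lecR.
rewrite quad_diagE => sum_ge0; case/negP: v0; apply/eqP/rowP => i; rewrite mxE.
have le0 j : (real_complex R) (e 0 j) * `|v 0 j| ^+ 2 <= 0.
  have [ej|/v_eq0 ->] := boolP (e 0 j < 0); last by rewrite normr0 expr0n mulr0.
  by rewrite mulr_le0_ge0 ?exprn_ge0 // lecR ltW.
have [ei|/v_eq0 //] := boolP (e 0 i < 0).
have /eqP : \sum_j - ((real_complex R) (e 0 j) * `|v 0 j| ^+ 2) = 0.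
  apply/eqP; rewrite eq_le sumr_ge0 ?andbT => [|j _]; last by rewrite oppr_ge0.
  by rewrite sumrN oppr_le0.
rewrite psumr_eq0 => [|j _]; last by rewrite oppr_ge0.
move=> /allP/(_ i); rewrite mem_index_enum oppr_eq0 mulf_eq0 sqrf_eq0 normr_eq0.
move=> /(_ isT)/orP[|/eqP //].
by rewrite fmorph_eq0 => /eqP e0; rewrite e0 ltxx in ei.
Qed.

(** A left inverse undoes the congruence, so [ind_congr_le] applies in both directions. *)
Lemma ind_congr p q (A : 'M[R]_p) (C : 'M[R]_(q, p)) (D : 'M[R]_(p, q)) :
  A^T = A -> D *m C = 1%:M -> ind (C *m A *m C^T) = ind A.
Proof.
move=> sA DC; apply/eqP; rewrite eqn_leq ind_congr_le //=.
have {1}-> : A = D *m (C *m A *m C^T) *m D^T.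
  rewrite !mulmxA DC mul1mx -mulmxA -trmx_mul DC trmx1 mulmx1 //.
by apply: ind_congr_le; rewrite !trmx_mul trmxK sA mulmxA.
Qed.

Lemma ind_block_diag p q (A : 'M[R]_p) (B : 'M[R]_q) : A^T = A -> B^T = B ->
  ind (block_mx A 0 0 B) = (ind A + ind B)%N.
Proof.
move=> /spectral_decomp_exists[d [P /char_poly_spectral_decomp dP]].
move=> /spectral_decomp_exists[e [Q /char_poly_spectral_decomp eQ]].
rewrite (ind_prod_XsubC dP) (ind_prod_XsubC eQ) -count_cat.
apply: ind_prod_XsubC; rewrite big_cat /= -dP -eQ.
rewrite /char_poly /char_poly_mx map_block_mx !map_mx0 (scalar_mx_block p q).
by rewrite opp_block_mx add_block_mx !oppr0 !addr0 det_ublock.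
Qed.

End Inertia.

(** * Identities for the Moore-Penrose inverse *)

Section PenroseInverse.
Variable R : realFieldType.

Lemma mpinvK m n (A : 'M[R]_(m, n)) : A *m mpinv A *m A = A.
Proof. by have /and4P[/eqP] := mpinvP A. Qed.

Lemma mpinvVK m n (A : 'M[R]_(m, n)) : mpinv A *m A *m mpinv A = mpinv A.
Proof. by have /and4P[_ /eqP] := mpinvP A. Qed.

Lemma tr_mulmx_mpinv m n (A : 'M[R]_(m, n)) : (A *m mpinv A)^T = A *m mpinv A.
Proof. by have /and4P[_ _ /eqP] := mpinvP A. Qed.

Lemma tr_mpinv_mulmx m n (A : 'M[R]_(m, n)) : (mpinv A *m A)^T = mpinv A *m A.
Proof. by have /and4P[_ _ _ /eqP] := mpinvP A. Qed.

Lemma mpinv_tr m n (A : 'M[R]_(m, n)) : mpinv A^T = (mpinv A)^T.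
Proof.
apply: penrose_uniq (mpinvP _) _; have /and4P[/eqP a /eqP b /eqP c /eqP d] := mpinvP A.
apply/and4P; split; rewrite -!trmx_mul ?c ?d // ?trmxK //.
  by rewrite mulmxA a.
by rewrite mulmxA b.
Qed.

Lemma mpinvN m n (A : 'M[R]_(m, n)) : mpinv (- A) = - mpinv A.
Proof.
apply: penrose_uniq (mpinvP _) _; have /and4P[/eqP a /eqP b /eqP c /eqP d] := mpinvP A.
by apply/and4P; split; rewrite !(mulNmx, mulmxN, opprK) ?a ?b ?c ?d.
Qed.

End PenroseInverse.

(** * Haynsworth's inertia formula with a singular corner *)

Section Haynsworth.
Variable R : rcfType.

(** The sum is the compression of the direct sum by the row of two identities. Conversely, the
    orthogonal projectors [P S1] and [P S2] onto the two ranges each annihilate the other summand,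
    and stacking them recovers the direct sum from the sum. *)
Lemma ind_add_ortho p (S1 S2 : 'M[R]_p) : S1^T = S1 -> S2^T = S2 ->
  S1 *m S2 = 0 -> ind (S1 + S2) = (ind S1 + ind S2)%N.
Proof.
move=> s1 s2 S12; rewrite -ind_block_diag //.
have S21 : S2 *m S1 = 0 by apply: trmx_inj; rewrite trmx_mul s1 s2 S12 trmx0.
have sB : (block_mx S1 0 0 S2)^T = block_mx S1 0 0 S2.
  by rewrite tr_block_mx !trmx0 s1 s2.
have sD : (S1 + S2)^T = S1 + S2 by rewrite linearD /= s1 s2.
apply/eqP; rewrite eqn_leq; apply/andP; split.
  have -> : S1 + S2 = row_mx 1%:M 1%:M *m block_mx S1 0 0 S2 *m (row_mx 1%:M 1%:M)^T.
    rewrite tr_row_mx trmx1 mul_row_block mul_row_col.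
    by rewrite !mul1mx !mulmx1 !addr0 !add0r.
  exact: ind_congr_le.
pose P (S : 'M[R]_p) := S *m mpinv S.
have PK S : P S *m S = S by exact: mpinvK.
have P0 (S S' : 'M[R]_p) : S^T = S -> S *m S' = 0 -> P S *m S' = 0.
  move=> sS SS'; rewrite -[P S]tr_mulmx_mpinv trmx_mul sS -mulmxA SS' mulmx0 //.
have -> : block_mx S1 0 0 S2 = col_mx (P S1) (P S2) *m (S1 + S2) *m (col_mx (P S1) (P S2))^T.
  rewrite mul_col_mx !mulmxDr !PK (P0 _ _ s1 S12) (P0 _ _ s2 S21) addr0 add0r.
  rewrite tr_col_mx mul_col_row.
  have PT (S S' : 'M[R]_p) : S'^T = S' -> S' *m (P S)^T = (P S *m S')^T by move=> sS'; rewrite [RHS]trmx_mul sS'.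
  by rewrite !PT // !PK (P0 _ _ s1 S12) (P0 _ _ s2 S21) s1 s2 trmx0.
exact: ind_congr_le.
Qed.

(** Changing the sign of one block of coordinates turns [H] into [- H], so both have the same index,
    which is half the rank of [H]. *)
Lemma ind_hyperbolic p q (C : 'M[R]_(p, q)) : ind (block_mx 0 C C^T 0) = \rank C.
Proof.
set H := block_mx _ _ _ _.
have sH : H^T = H by rewrite tr_block_mx !trmx0 trmxK.
pose F : 'M[R]_(p + q) := block_mx 1%:M 0 0 (- 1%:M).
have FF : F *m F = 1%:M.
  rewrite mulmx_block !mulmx0 !mul0mx !addr0 add0r mulNmx mulmxN opprK !mulmx1.
  by rewrite -scalar_mx_block.
have sF : F^T = F by rewrite tr_block_mx !trmx0 linearN /= !trmx1.
have HN : - H = F *m H *m F^T.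
  rewrite sF !mulmx_block !(mulmx0, mul0mx, mul1mx, mulmx1, addr0, add0r).
  by rewrite !(mulNmx, mulmxN, mul1mx, mulmx1) opp_block_mx !oppr0.
have indN : ind (- H) = ind H by rewrite HN; apply: ind_congr FF.
have rH : \rank H = (\rank C + \rank C)%N.
  have -> : H = block_mx C 0 0 C^T *m block_mx 0 1%:M 1%:M 0.
    by rewrite mulmx_block !(mulmx0, mul0mx, mulmx1, addr0, add0r).
  rewrite mxrankMfree ?rank_diag_block_mx ?mxrank_tr //.
  apply/row_freeP; exists (block_mx 0 1%:M 1%:M 0).
  rewrite mulmx_block !(mulmx0, mul0mx, mulmx1, addr0, add0r).
  by rewrite -scalar_mx_block.
by have := ind_add_indN sH; rewrite indN rH !addnn => /double_inj.
Qed.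

(** Congruence by a block unitriangular matrix. The free [K] serves once to form a Schur complement
    and once to compress it. *)
Lemma ind_shear p q (A : 'M[R]_p) (C : 'M[R]_(p, q)) (D : 'M[R]_q)
    (K : 'M[R]_(q, p)) : A^T = A -> D^T = D ->
  ind (block_mx A C C^T D) =
  ind (block_mx A (C - A *m K^T) (C - A *m K^T)^T
                (D - (K *m C + (K *m C)^T) + K *m A *m K^T)).
Proof.
move=> sA sD; pose L (X : 'M[R]_(q, p)) : 'M[R]_(p + q) := block_mx 1%:M 0 X 1%:M.
have LL : L K *m L (- K) = 1%:M.
  rewrite mulmx_block !(mulmx0, mul0mx, mul1mx, mulmx1, addr0, add0r) subrr.
  by rewrite -scalar_mx_block.
rewrite -(ind_congr _ LL) ?tr_block_mx ?trmxK ?sA ?sD //; congr (ind _).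
rewrite !mulmx_block !(mulmx0, mul0mx, mul1mx, mulmx1, addr0, add0r).
rewrite !trmx0 !trmx1 !(mulmx1, mulmx0, addr0) linearN /= !mulmxN !mulNmx.
congr block_mx; first by rewrite addrC.
  by rewrite linearB /= trmx_mul trmxK sA addrC.
rewrite mulmxDl mulNmx trmx_mul opprD opprK addrC.
set KC := K *m C; set CK := C^T *m K^T; set KAK := _ *m K^T.
by apply/matrixP => i j; rewrite !mxE; ring.
Qed.

(* Haynsworth's inertia formula for a possibly singular block A: with
   C0 = (1 - A A^+) C, congruence removes A A^+ C and reduces D to its
   compression to the kernel of C0; the rest splits off as a hyperbolic form. *)
Lemma haynsworth p q (A : 'M[R]_p) (C : 'M[R]_(p, q)) (D T : 'M[R]_q)
    (F : 'M[R]_(q, p)) (C0 := (1%:M - A *m mpinv A) *m C) :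
  A^T = A -> D^T = D -> T^T = T -> C0 *m T = 0 -> 1%:M - T = F *m C0 ->
  ind (block_mx A C C^T D) =
  (ind A + \rank C0 + ind (T *m (D - C^T *m mpinv A *m C) *m T))%N.
Proof.
move=> sA sD sT C0T TF.
pose Pi := A *m mpinv A; pose G := mpinv A.
have sG : G^T = G by rewrite -mpinv_tr sA.
have sPi : Pi^T = Pi by apply: tr_mulmx_mpinv.
have PiA : Pi *m A = A by apply: mpinvK.
have APi : A *m Pi = A by apply: trmx_inj; rewrite trmx_mul sPi sA.
have AC0 : A *m C0 = 0 by rewrite mulmxA mulmxBr mulmx1 APi subrr mul0mx.
pose E := D - C^T *m G *m C.
have sE : E^T = E by rewrite linearB /= !trmx_mul trmxK sG sD mulmxA.
(* Chosen so that [K] kills [A] while [K *m C0] plus its transpose is [E - T *m E *m T]: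
   symmetrising [(1 + T) E (1 - T)] gives twice that difference, whence the factor 1/2. *)
pose K : 'M[R]_(q, p) := 2^-1 *: ((1%:M + T) *m E *m F *m (1%:M - Pi)).
have KA : K *m A = 0.
  by rewrite -scalemxAl -mulmxA mulmxBl mul1mx PiA subrr mulmx0 scaler0.
have C0E : (1%:M - Pi) *m C0 = C0.
  by rewrite mulmxBl mul1mx [Pi *m C0]mulmxA mulmxBr mulmx1 [Pi *m (A *m _)]mulmxA PiA subrr mul0mx subr0.
have KC0 : K *m C0 = 2^-1 *: ((1%:M + T) *m E *m (1%:M - T)).
  by rewrite -scalemxAl -mulmxA C0E TF !mulmxA.
have ET : E - (K *m C0 + (K *m C0)^T) = T *m E *m T.
  rewrite KC0 linearZ /= !trmx_mul [(1%:M - T)^T]linearB [(1%:M + T)^T]linearD /=.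
  rewrite trmx1 sT sE -scalerDr mulmxA.
  set X := (1%:M + T) *m _ *m _ + _.
  have -> : X = 2 *: (E - T *m E *m T).
    rewrite /X !(mulmxDl, mulmxDr, mulmxN, mulNmx, mul1mx, mulmx1).
    move: (T *m E) (E *m T) (T *m E *m T) => TE ET TET.
    by apply/matrixP => i j; rewrite !mxE; ring.
  by rewrite scalerA mulVf ?pnatr_eq0 // scale1r opprB addrC subrK.
(* The first shear turns the off-diagonal block into [C0] and the corner into the Schur complement
   [E]. *)
rewrite (ind_shear _ (C^T *m G)) //.
have -> : C - A *m (C^T *m G)^T = C0.
  by rewrite trmx_mul trmxK sG mulmxA [RHS]mulmxBl mul1mx.
have -> : D - (C^T *m G *m C + (C^T *m G *m C)^T) + C^T *m G *m A *m (C^T *m G)^T = E.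
  rewrite !trmx_mul !trmxK sG.
  have -> : C^T *m G *m A *m (G *m C) = C^T *m (G *m A *m G) *m C by rewrite !mulmxA.
  rewrite mpinvVK mulmxA /E; move: (C^T *m G *m C) => X.
  by apply/matrixP => i j; rewrite !mxE; ring.
rewrite (ind_shear _ K) // ET -[A *m K^T]trmxK trmx_mul trmxK sA KA trmx0 subr0 mul0mx addr0.
(* The two summands have product zero because [A *m C0] and [C0 *m T] vanish. *)
have -> : block_mx A C0 C0^T (T *m E *m T) =
    block_mx A 0 0 (T *m E *m T) + block_mx 0 C0 C0^T 0.
  by rewrite add_block_mx !addr0 !add0r.
have sTET : (T *m E *m T)^T = T *m E *m T by rewrite !trmx_mul sT sE mulmxA.
rewrite ind_add_ortho.
- by rewrite ind_block_diag // ind_hyperbolic addnAC.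
- by rewrite tr_block_mx !trmx0 sA sTET.
- by rewrite tr_block_mx !trmx0 trmxK.
rewrite mulmx_block !(mulmx0, mul0mx, addr0, add0r) AC0 -mulmxA.
by rewrite -sT -trmx_mul C0T trmx0 mulmx0 block_mx_const.
Qed.

End Haynsworth.

(** * The comparative index expressed by symmetric matrices *)

Section Charts.
Variables (R : rcfType) (n : nat).
Implicit Types (A B E G H T : 'M[R]_n) (Y Yh V W : 'M[R]_(n + n, n)).

(** The direct sum of [A - B] and [B] is congruent, through [L], to the block matrix with corners
    [A] and [H^T *m B *m H] and off-diagonal block [B *m H]; Haynsworth's formula with pivot [A]
    computes its index. *)
Lemma ind_sub_add A B H T F (C0 := (1%:M - A *m mpinv A) *m (B *m H)) :
  A^T = A -> B^T = B -> H \in unitmx -> T^T = T ->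
  C0 *m T = 0 -> 1%:M - T = F *m C0 ->
  (\rank C0 + ind (T *m (H^T *m (B - B *m mpinv A *m B) *m H) *m T) + ind A
   = ind (A - B) + ind B)%N.
Proof.
move=> sA sB uH sT C0T TF.
have sD : (H^T *m B *m H)^T = H^T *m B *m H by rewrite !trmx_mul trmxK sB mulmxA.
have := haynsworth sA sD sT C0T TF; rewrite -/C0.
have -> : H^T *m B *m H - (B *m H)^T *m mpinv A *m (B *m H) =
    H^T *m (B - B *m mpinv A *m B) *m H.
  by rewrite trmx_mul sB mulmxBr mulmxBl !mulmxA.
have sAB : (A - B)^T = A - B by rewrite linearB /= sA sB.
rewrite -(ind_block_diag sAB sB).
set L : 'M[R]_(n + n) := block_mx 1%:M 1%:M 0 H^T.
have LL : block_mx 1%:M (- invmx H^T) 0 (invmx H^T) *m L = 1%:M.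
  rewrite mulmx_block !(mulmx0, mul0mx, mul1mx, mulmx1, addr0, add0r).
  by rewrite mulNmx mulVmx ?unitmx_tr // subrr -scalar_mx_block.
rewrite -(@ind_congr _ _ _ (block_mx (A - B) 0 0 B) _ _ _ LL); last first.
  by rewrite tr_block_mx !trmx0 sAB sB.
rewrite [_ *m L^T](_ : _ = block_mx A (B *m H) (B *m H)^T (H^T *m B *m H)).
  by move=> ->; rewrite addnC addnA.
rewrite tr_block_mx !trmx0 !trmx1 trmxK trmx_mul sB.
by rewrite !mulmx_block !(mulmx0, mul0mx, mul1mx, mulmx1, addr0, add0r) subrK.
Qed.

(* In coordinates where the Lagrangian planes b, Y, Yh are the graphs of
   symmetric matrices A_b, A_Y, A_Yh, the hypotheses hold with
   A = A_Y - A_b and B = A_Yh - A_b. *)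
Lemma comp_index_graph Y Yh A B E G H :
  A^T = A -> B^T = B -> E \in unitmx -> G \in unitmx -> H \in unitmx ->
  usubmx Y = E *m A *m G -> usubmx Yh = E *m B *m H ->
  wronskian Y Yh = G^T *m (A - B) *m H ->
  (comp_index Y Yh + ind A = ind (A - B) + ind B)%N /\
  (dual_comp_index Y Yh + ind (- A) = ind (B - A) + ind (- B))%N.
Proof.
move=> sA sB uE uG uH XE XhE wE.
rewrite /comp_index /dual_comp_index /ci_P.
set M := ci_M Y Yh; set T := ci_T Y Yh; set X := usubmx Y.
set Xp := mpinv X; set w := wronskian Y Yh.
have ME : M = (1%:M - Xp *m X) *m w by [].
have TE : T = 1%:M - mpinv M *m M by [].
rewrite -/w in wE; clearbody M T w.
have sT : T^T = T by rewrite TE linearB /= trmx1 tr_mpinv_mulmx.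
have MT : M *m T = 0 by rewrite TE mulmxBr mulmx1 mulmxA mpinvK subrr.
(* [Xp *m X] is the orthogonal projector onto the range of [X^T], so its complement kills [X^T] and
   hence [G^T *m A]. *)
have NX : (1%:M - Xp *m X) *m X^T = 0.
  rewrite -[Xp *m X]tr_mpinv_mulmx -[1%:M]trmx1 -linearB /= -trmx_mul.
  by rewrite mulmxBr mulmx1 mulmxA mpinvK subrr trmx0.
have XtE : X^T = G^T *m A *m E^T by rewrite /X XE !trmx_mul sA mulmxA.
have NGA : (1%:M - Xp *m X) *m G^T *m A = 0.
  have uEt : E^T \in unitmx by rewrite unitmx_tr.
  apply: (can_inj (mulmxK uEt)); rewrite mul0mx -!mulmxA (mulmxA G^T) -XtE.
  exact: NX.
pose C0 := (1%:M - A *m mpinv A) *m (B *m H).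
(* [M *m T = 0] says that [w *m T] lies in the range of [X^T]; [L] is the resulting solution of
   [(A - B) *m H *m T = A *m L]. *)
pose L := E^T *m Xp^T *m w *m T.
have AL : (A - B) *m H *m T = A *m L.
  have uGt : G^T \in unitmx by rewrite unitmx_tr.
  apply: (can_inj (mulKmx uGt)); rewrite !mulmxA -wE -XtE -trmx_mul tr_mpinv_mulmx.
  have := MT; rewrite ME mulmxBl mul1mx mulmxBl.
  by move=> /eqP; rewrite subr_eq0 => /eqP.
clearbody L; pose Z := H *m T - L.
have BHT : B *m H *m T = A *m Z.
  by rewrite mulmxBr -AL !mulmxBl mulmxA opprB addrC subrK.
have C0T : C0 *m T = 0.
  by rewrite -mulmxA BHT mulmxA mulmxBl mul1mx mpinvK subrr mul0mx.
pose N := (1%:M - Xp *m X) *m G^T.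
(* [M] and [C0] turn out to be left multiples of each other, so they have equal rank and [T]
   satisfies the hypotheses of [ind_sub_add]. *)
have MQ : M = - N *m C0.
  have NAB : N *m (A *m mpinv A *m (B *m H)) = 0 by rewrite !mulmxA NGA !mul0mx.
  rewrite mulNmx [C0]mulmxBl mul1mx [N *m _]mulmxBr NAB subr0 mulmxA -mulNmx.
  by rewrite -[- (N *m B)]sub0r -NGA -mulmxBr ME wE !mulmxA.
have TQ : 1%:M - T = mpinv M *m - N *m C0 by rewrite -mulmxA -MQ TE opprB addrC subrK.
have rkM : \rank M = \rank C0.
  apply/eqP; rewrite eqn_leq {1}MQ mxrankM_maxr /=.
  have -> : C0 = C0 *m mpinv M *m M.
    by rewrite -mulmxA [mpinv M *m M](_ : _ = 1%:M - T) ?mulmxBr ?mulmx1 ?C0T ?subr0 // TE opprB addrC subrK.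
  exact: mxrankM_maxr.
(* Both sides reduce to [L^T *m A *m Z], by [AL] and [BHT]. *)
have PE : T *m w^T *m Xp *m usubmx Yh *m T =
    T *m (H^T *m (B - B *m mpinv A *m B) *m H) *m T.
  transitivity (L^T *m A *m Z).
    rewrite -{1}sT -trmx_mul wE -!(mulmxA G^T) AL XhE.
    rewrite -!mulmxA (mulmxA B) BHT !trmx_mul trmxK sA !mulmxA.
    have -> : L^T *m A *m G = L^T *m invmx E *m X.
      by rewrite /X XE -!mulmxA mulKmx.
    have -> : L^T *m invmx E *m X *m Xp *m E *m A *m Z =
        L^T *m invmx E *m (X *m Xp *m (E *m A *m G)) *m invmx G *m Z.
      by rewrite -!mulmxA mulKVmx.
    by rewrite -XE mpinvK /X XE !mulmxA mulmxKV // mulmxK.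
  have -> : T *m (H^T *m (B - B *m mpinv A *m B) *m H) *m T =
      (H *m T)^T *m (B *m H *m T) - (B *m H *m T)^T *m mpinv A *m (B *m H *m T).
    by rewrite !trmx_mul sT sB mulmxBr !mulmxBl mulmxBr mulmxBl !mulmxA.
  rewrite BHT [(A *m Z)^T]trmx_mul sA.
  have -> : Z^T *m A *m mpinv A *m (A *m Z) = Z^T *m (A *m mpinv A *m A) *m Z.
    by rewrite !mulmxA.
  have LE : L = H *m T - Z by rewrite /Z subKr.
  by rewrite mpinvK LE [(_ - Z)^T]linearB /= !mulmxBl !mulmxA.
rewrite rkM PE; split; first exact: ind_sub_add sA sB uH sT C0T TQ.
(* For the dual index [A] and [B] change sign: [C0] is negated, which keeps its rank, and so is the
   compressed form. *)
have C0N : (1%:M - - A *m mpinv (- A)) *m (- B *m H) = - C0.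
  by rewrite mpinvN !mulNmx mulmxN opprK mulmxN.
have SN : - B - - B *m mpinv (- A) *m - B = - (B - B *m mpinv A *m B).
  by rewrite mpinvN !(mulNmx, mulmxN, opprK) opprB addrC.
have := @ind_sub_add (- A) (- B) H T (mpinv M *m N).
rewrite /= C0N mxrank_opp SN opprK [- A + B]addrC !(mulmxN, mulNmx) C0T oppr0.
rewrite !mulmxN !mulNmx in TQ.
have sN (C : 'M[R]_n) : C^T = C -> (- C)^T = - C by move=> sC; rewrite linearN /= sC.
by move=> ind_eq; apply: ind_eq => //; apply: sN.
Qed.

End Charts.

(** * A common chart for finitely many Lagrangian planes *)

Section Chart.
Variables (R : rcfType) (n : nat).
Implicit Types (V W : 'M[R]_(n + n, n)) (Z : 'M[R]_(n + n)) (c : R).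

(* The shear (X, U) -> (X, U + c X) makes V the graph of [chart c V] over the
   second factor, provided that [chart_den c V] is invertible. *)
Definition chart_den c V : 'M[R]_n := dsubmx V + c *: usubmx V.

Definition chart c V : 'M[R]_n := usubmx V *m invmx (chart_den c V).

Lemma wronskianE V W :
  wronskian V W = (usubmx V)^T *m dsubmx W - (dsubmx V)^T *m usubmx W.
Proof.
rewrite /wronskian -{1}[V]vsubmxK -{1}[W]vsubmxK tr_col_mx mul_row_block.
by rewrite mul_row_col !mulmx0 mulmxN !mulmx1 addr0 add0r addrC mulNmx.
Qed.

(** The shear is symplectic, so the terms in [c] cancel. *)
Lemma wronskian_chart_den c V W :
  wronskian V W = (usubmx V)^T *m chart_den c W - (chart_den c V)^T *m usubmx W.
Proof.
have -> : (chart_den c V)^T = (dsubmx V)^T + c *: (usubmx V)^T.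
  by rewrite linearD linearZ.
rewrite wronskianE mulmxDl mulmxDr -scalemxAl -scalemxAr.
by rewrite opprD addrACA subrr addr0.
Qed.

Lemma chartK c V : chart_den c V \in unitmx ->
  chart c V *m chart_den c V = usubmx V.
Proof. by move=> uV; rewrite mulmxKV. Qed.

(** Symmetry of the chart matrix is the isotropy [w(V, V) = 0]. *)
Lemma tr_chart c V : frame V -> chart_den c V \in unitmx ->
  (chart c V)^T = chart c V.
Proof.
move=> [wV _] uV; have uVt : (chart_den c V)^T \in unitmx by rewrite unitmx_tr.
move/eqP: wV; rewrite (wronskian_chart_den c) subr_eq0 => /eqP XV.
apply: (can_inj (mulmxK uV)); rewrite chartK // trmx_mul trmx_inv -mulmxA XV.
by rewrite mulKmx.
Qed.

Lemma wronskian_chart c V W : frame V ->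
  chart_den c V \in unitmx -> chart_den c W \in unitmx ->
  wronskian V W = (chart_den c V)^T *m (chart c V - chart c W) *m chart_den c W.
Proof.
move=> fV uV uW; rewrite mulmxBr mulmxBl -[_ *m chart c W *m _]mulmxA chartK //.
by rewrite -{1}(tr_chart fV uV) -trmx_mul chartK // (wronskian_chart_den c).
Qed.

Lemma wronskian_symplectic Z V W : symplectic Z ->
  wronskian (Z *m V) (Z *m W) = wronskian V W.
Proof.
move=> sZ; rewrite /wronskian trmx_mul -!mulmxA (mulmxA Z^T) (mulmxA (Z^T *m _)).
by rewrite sZ.
Qed.

(** The upper block of a frame is minus its Wronskian with b. Since [Z] preserves Wronskians and
    sends [Vb] to b, the upper block of [Z *m V] is governed by [chart c V - chart c Vb], as
    [comp_index_graph] requires. *)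
Lemma comp_index_chart Z c Vb V W :
  symplectic Z -> frame Vb -> frame V -> frame W ->
  chart_den c Vb \in unitmx -> chart_den c V \in unitmx ->
  chart_den c W \in unitmx -> Z *m Vb = bmx R n ->
  (comp_index (Z *m V) (Z *m W) + ind (chart c V - chart c Vb)
   = ind (chart c V - chart c W) + ind (chart c W - chart c Vb))%N /\
  (dual_comp_index (Z *m V) (Z *m W) + ind (chart c Vb - chart c V)
   = ind (chart c W - chart c V) + ind (chart c Vb - chart c W))%N.
Proof.
move=> sZ fb fV fW ub uV uW Zb.
have usubE V' : chart_den c V' \in unitmx -> usubmx (Z *m V') =
    (chart_den c Vb)^T *m (chart c V' - chart c Vb) *m chart_den c V'.
  move=> uV'; rewrite -opprB mulmxN mulNmx -(wronskian_chart fb ub uV').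
  rewrite -(wronskian_symplectic _ _ sZ) Zb wronskianE col_mxKu col_mxKd.
  by rewrite trmx0 trmx1 mul0mx mul1mx sub0r opprK.
have subE (A B C : 'M[R]_n) : A - C - (B - C) = A - B.
  by rewrite opprB addrA subrK.
have sE V' : frame V' -> chart_den c V' \in unitmx ->
    (chart c V' - chart c Vb)^T = chart c V' - chart c Vb.
  by move=> f u; rewrite linearB /= !tr_chart.
have ubt : (chart_den c Vb)^T \in unitmx by rewrite unitmx_tr.
have wE : wronskian (Z *m V) (Z *m W) = (chart_den c V)^T *m
   ((chart c V - chart c Vb) - (chart c W - chart c Vb)) *m chart_den c W.
  by rewrite subE wronskian_symplectic // (wronskian_chart fV uV uW).
have := comp_index_graph (sE _ fV uV) (sE _ fW uW) ubt uV uW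
  (usubE _ uV) (usubE _ uW) wE.
by rewrite !subE !opprB.
Qed.

Lemma gram_frame_unit V : frame V ->
  (usubmx V)^T *m usubmx V + (dsubmx V)^T *m dsubmx V \in unitmx.
Proof.
move=> [_ rV]; rewrite -mul_row_col -tr_col_mx vsubmxK -{2}[V]trmxK.
by apply: gram_unit; rewrite /row_free mxrank_tr rV.
Qed.

(* If U + c X is singular then c^2 is a root of det (U^T U - y X^T X), a
   polynomial in y that does not vanish at y = -1. *)
Lemma chart_exists m (V : nat -> 'M[R]_(n + n, n)) :
  (forall k, (k < m)%N -> frame (V k)) ->
  exists c, forall k, (k < m)%N -> chart_den c (V k) \in unitmx.
Proof.
move=> fV.
pose X k := usubmx (V k); pose U k := dsubmx (V k).
pose g k := \det (map_mx polyC ((U k)^T *m U k)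
                  - 'X *: map_mx polyC ((X k)^T *m X k)).
have gE k y : (g k).[y] = \det ((U k)^T *m U k - y *: ((X k)^T *m X k)).
  rewrite -[LHS]/(horner_eval y (g k)) -det_map_mx; congr (\det _).
  by apply/matrixP => i j; rewrite !mxE /= /horner_eval !hornerE.
have g0 k : (k < m)%N -> g k != 0.
  move=> /fV/gram_frame_unit; apply: contraTneq => gk.
  rewrite unitmxE -/(X k) -/(U k).
  have -> : (X k)^T *m X k + (U k)^T *m U k = (U k)^T *m U k - -1 *: ((X k)^T *m X k).
    by rewrite scaleN1r opprK addrC.
  by rewrite -gE gk horner0 unitr0.
pose G := \prod_(k < m) g k.
have G0 : G != 0 by apply/prodf_neq0 => k _; apply: g0.
(* These are [size G] distinct squares, one more than the degree of [G], so one of them is not a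
   root. *)
pose s : seq R := [seq k%:R ^+ 2 | k <- iota 0 (size G)].
have us : uniq s.
  rewrite map_inj_uniq ?iota_uniq // => i j /eqP.
  by rewrite -!natrX eqr_nat eqn_sqr => /eqP.
have /allPn[_ /mapP[j _ ->] Gj] : ~~ all (root G) s.
  apply/negP => /(max_poly_roots G0)/(_ us).
  by rewrite size_map size_iota ltnn.
exists j%:R => k km.
have : (g k).[j%:R ^+ 2] != 0.
  move: Gj; rewrite /root /G horner_prod => /prodf_neq0/(_ (Ordinal km) isT) //.
have [wk _] := fV k km; move/eqP: wk; rewrite wronskianE subr_eq0 -/(X k) -/(U k).
move=> /eqP XU; rewrite gE unitmxE unitfE.
(* Isotropy makes [X^T U] symmetric, so the cross terms cancel and the difference of squares
   factors. *)
have -> : (U k)^T *m U k - j%:R ^+ 2 *: ((X k)^T *m X k) =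
    (U k - j%:R *: X k)^T *m chart_den j%:R (V k).
  have -> : (U k - j%:R *: X k)^T = (U k)^T - j%:R *: (X k)^T.
    by rewrite linearB linearZ.
  rewrite /chart_den -/(X k) -/(U k) mulmxBl !mulmxDr.
  rewrite -!scalemxAl -!scalemxAr XU scalerA -expr2.
  by rewrite opprD addrA addrK.
by rewrite det_mulmx mulf_eq0 negb_or => /andP[].
Qed.

Lemma chart_bmx c : chart c (bmx R n) = 0.
Proof. by rewrite /chart col_mxKu mul0mx. Qed.

Lemma chart_den_bmx c : chart_den c (bmx R n) = 1%:M.
Proof. by rewrite /chart_den col_mxKu col_mxKd scaler0 addr0. Qed.

Lemma frame_bmx : frame (bmx R n).
Proof.
rewrite -[bmx R n]mul1mx; apply: symplectic_frame.
by rewrite /symplectic trmx1 mul1mx mulmx1.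
Qed.

(** The case where the reference plane is b itself, whose chart matrix is 0. *)
Lemma comp_index_chart_b c V W : frame V -> frame W ->
  chart_den c V \in unitmx -> chart_den c W \in unitmx ->
  (comp_index V W + ind (chart c V)
   = ind (chart c V - chart c W) + ind (chart c W))%N /\
  (dual_comp_index V W + ind (- chart c V)
   = ind (chart c W - chart c V) + ind (- chart c W))%N.
Proof.
move=> fV fW uV uW.
have s1 : symplectic (1%:M : 'M[R]_(n + n)).
  by rewrite /symplectic trmx1 mul1mx mulmx1.
have ub : chart_den c (bmx R n) \in unitmx by rewrite chart_den_bmx unitmx1.
have := comp_index_chart s1 frame_bmx fV fW ub uV uW (mul1mx _).
by rewrite chart_bmx !mul1mx !subr0 !sub0r.
Qed.

End Chart.

(** * Telescoping sums of natural numbers, written without subtraction *)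

Lemma sum_telescope_up m (f g h : nat -> nat) :
  (forall k, (k < m)%N -> (f k + h k = g k + h k.+1)%N) ->
  (\sum_(0 <= k < m) f k + h 0 = \sum_(0 <= k < m) g k + h m)%N.
Proof.
elim: m => [|m IHm] E; first by rewrite !big_geq.
rewrite !big_nat_recr //=; have := E m (leqnn _).
by have := IHm (fun k km => E k (leqW km)); lia.
Qed.

Lemma sum_telescope_down m (f g h : nat -> nat) :
  (forall k, (k < m)%N -> (f k + h k.+1 = g k + h k)%N) ->
  (\sum_(0 <= k < m) f k + h m = \sum_(0 <= k < m) g k + h 0)%N.
Proof.
elim: m => [|m IHm] E; first by rewrite !big_geq.
rewrite !big_nat_recr //=; have := E m (leqnn _).
by have := IHm (fun k km => E k (leqW km)); lia.
Qed.

(** * Focal points and cyclic sums in the common chart *)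

Section System.
Variables (R : rcfType) (n N : nat) (S Z : nat -> 'M[R]_(n + n)).
Hypotheses (sS : symplectic_system N S) (fZ : fundamental_matrix N S Z).

Let V k := invmx (Z k) *m bmx R n.

Lemma frame_fundamental k : (k <= N.+1)%N -> frame (V k).
Proof. by move=> lek; apply/symplectic_frame/symplectic_inv; apply: (proj1 fZ). Qed.

Let unitZ k : (k <= N.+1)%N -> Z k \in unitmx.
Proof. by move=> lek; apply/symplectic_unit/(proj1 fZ). Qed.

Lemma fundamentalK k : (k <= N.+1)%N -> Z k *m V k = bmx R n.
Proof. by move=> lek; rewrite mulKVmx ?unitZ. Qed.

(** Together with [shift_inv_bmx], this makes every focal-point term a comparative index of two
    planes [V] moved by one and the same [Z]. *)
Lemma shift_bmx k : (k <= N)%N -> S k *m bmx R n = Z k.+1 *m V k.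
Proof.
by move=> lek; rewrite (proj2 fZ) // -mulmxA fundamentalK // leqW.
Qed.

Lemma shift_inv_bmx k : (k <= N)%N -> invmx (S k) *m bmx R n = Z k *m V k.+1.
Proof.
move=> lek; rewrite -(fundamentalK (k := k.+1)) // (proj2 fZ) // -mulmxA mulKmx //.
exact/symplectic_unit/sS.
Qed.

(** [invmx (Z j) *m Y j] is constant in [j], and its value is read off at [j = M]. *)
Lemma principal_solutionE M Y k : (M <= N.+1)%N -> principal_solution N S M Y ->
  (k <= N.+1)%N -> Y k = Z k *m V M.
Proof.
move=> leM [[_ eY] YM].
have cst j : (j <= N.+1)%N -> invmx (Z j) *m Y j = invmx (Z 0) *m Y 0%N.
  elim: j => // j IHj lej; rewrite -IHj 1?ltnW //.
  apply: (can_inj (mulKmx (unitZ lej))); rewrite mulKVmx ?unitZ // eY //.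
  by rewrite (proj2 fZ) // -mulmxA mulKVmx ?unitZ // ltnW.
by move=> lek; rewrite /V -YM cst // -(cst k) // mulKVmx ?unitZ.
Qed.

Variable c : R.
Hypothesis uV : forall k, (k <= N.+1)%N -> chart_den c (V k) \in unitmx.

Let a k := chart c (V k).
Let step := (\sum_(0 <= k < N.+1) ind (a k - a k.+1))%N.

(** In the term of index [k] the reference plane is [V k], which [Z k] maps to b; the terms
    [ind (a k - a M)] telescope. *)
Lemma backward_focal_chart M Y : (M <= N.+1)%N -> principal_solution N S M Y ->
  (backward_focal N S Y + ind (a 0 - a M) = step + ind (a N.+1 - a M))%N.
Proof.
move=> leM pY; apply: (@sum_telescope_up _ _ _ (fun k => ind (a k - a M))) => k ltk.
have lek := ltnW ltk.
rewrite (principal_solutionE leM pY lek) (shift_inv_bmx ltk).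
have [_ E] := comp_index_chart (proj1 fZ k lek) (frame_fundamental lek)
  (frame_fundamental leM) (frame_fundamental ltk) (uV lek) (uV leM) (uV ltk)
  (fundamentalK lek).
exact: etrans E (addnC _ _).
Qed.

(** Here the reference plane is [V k.+1], mapped to b by [Z k.+1], and the telescoping terms are
    [ind (a M - a k)]. *)
Lemma forward_focal_chart M Y : (M <= N.+1)%N -> principal_solution N S M Y ->
  (forward_focal N S Y + ind (a M - a N.+1) = step + ind (a M - a 0))%N.
Proof.
move=> leM pY; apply: (@sum_telescope_down _ _ _ (fun k => ind (a M - a k))) => k ltk.
have lek := ltnW ltk.
rewrite (principal_solutionE leM pY ltk) (shift_bmx ltk).
have [E _] := comp_index_chart (proj1 fZ _ ltk) (frame_fundamental ltk)
  (frame_fundamental leM) (frame_fundamental lek) (uV ltk) (uV leM) (uV lek)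
  (fundamentalK ltk).
exact: etrans E (addnC _ _).
Qed.

Lemma sum_comp_index_chart :
  (\sum_(0 <= k < N.+1) comp_index (V k) (V k.+1) + ind (a 0)
   = step + ind (a N.+1))%N.
Proof.
apply: (@sum_telescope_up _ _ _ (fun k => ind (a k))) => k ltk; have lek := ltnW ltk.
have [E _] := comp_index_chart_b (frame_fundamental lek)
  (frame_fundamental ltk) (uV lek) (uV ltk).
exact: E.
Qed.

Lemma sum_dual_comp_index_chart :
  (\sum_(0 <= k < N.+1) dual_comp_index (V k.+1) (V k) + ind (- a N.+1)
   = step + ind (- a 0))%N.
Proof.
apply: (@sum_telescope_down _ _ _ (fun k => ind (- a k))) => k ltk; have lek := ltnW ltk.
have [_ E] := comp_index_chart_b (frame_fundamental ltk)
  (frame_fundamental lek) (uV ltk) (uV lek).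
exact: E.
Qed.

Let cyclic_step M M' : (M <= N.+1)%N -> (M' <= N.+1)%N ->
  (comp_index (V M) (V M') + ind (a M) = ind (a M - a M') + ind (a M'))%N /\
  (dual_comp_index (V M) (V M') + ind (- a M) = ind (a M' - a M) + ind (- a M'))%N.
Proof. by move=> le1 le2; apply: comp_index_chart_b; auto using frame_fundamental. Qed.

Lemma sum_fwd (f : 'M[R]_(n + n, n) -> 'M[R]_(n + n, n) -> nat) :
  (\sum_(1 <= k < N.+2) f (V k.-1) (V k.+1.-1) =
   \sum_(0 <= k < N.+1) f (V k) (V k.+1))%N.
Proof. by rewrite big_add1. Qed.

(** The index [N.+2 - i] lists [V N.+1] down to [V 0] for [i] from 1 to [N.+2]; reversing the
    summation restores increasing order. *)
Lemma sum_bwd (f : 'M[R]_(n + n, n) -> 'M[R]_(n + n, n) -> nat) :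
  (\sum_(1 <= k < N.+2) f (V (N.+2 - k)) (V (N.+2 - k.+1)) =
   \sum_(0 <= k < N.+1) f (V k.+1) (V k))%N.
Proof.
rewrite big_add1 big_nat_rev /= add0n; apply: eq_big_nat => k /andP[_ ltk].
by congr (f (V _) (V _)); lia.
Qed.

(** The closing term brings [ind (a N.+1 - a 0)], and its [ind (a 0)] and [ind (a N.+1)] cancel
    those left by the telescoped sum. *)
Lemma mu_c_minus_chart :
  mu_c_minus N.+2 (fun i => V i.-1) = (step + ind (a N.+1 - a 0))%N.
Proof.
rewrite /mu_c_minus sum_fwd /=; have := sum_comp_index_chart.
by have [+ _] := cyclic_step (leqnn N.+1) (leq0n N.+1); lia.
Qed.

Lemma mu_c_plus_chart :
  mu_c_plus N.+2 (fun i => V (N.+2 - i)%N) = (step + ind (a N.+1 - a 0))%N.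
Proof.
rewrite /mu_c_plus sum_bwd subnn subn1 /=; have := sum_dual_comp_index_chart.
by have [_] := cyclic_step (leq0n N.+1) (leqnn N.+1); lia.
Qed.

(** The subtracted term joins the same endpoints in the opposite order, which leaves
    [ind (a 0 - a N.+1)] with a minus sign. *)
Lemma nu_c_minus_chart :
  nu_c_minus N.+2 (fun i => V i.-1) = step%:Z - (ind (a 0 - a N.+1))%:Z.
Proof.
rewrite /nu_c_minus sum_fwd /=; have := sum_comp_index_chart.
by have [+ _] := cyclic_step (leq0n N.+1) (leqnn N.+1); lia.
Qed.

Lemma nu_c_plus_chart :
  nu_c_plus N.+2 (fun i => V (N.+2 - i)%N) = step%:Z - (ind (a 0 - a N.+1))%:Z.
Proof.
rewrite /nu_c_plus sum_bwd subnn subn1 /=; have := sum_dual_comp_index_chart.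
by have [_] := cyclic_step (leqnn N.+1) (leq0n N.+1); lia.
Qed.

(** For [M] equal to 0 or [N.+1], one of the two boundary terms in the focal-point formulas is the
    index of the zero matrix; the other is the one found in the cyclic sums. *)
Lemma focal_points_chart : exists (p : nat) (q : int),
  [/\ mu_c_minus N.+2 (fun i => V i.-1) = p,
      mu_c_plus N.+2 (fun i => V (N.+2 - i)%N) = p,
      nu_c_minus N.+2 (fun i => V i.-1) = q
    & nu_c_plus N.+2 (fun i => V (N.+2 - i)%N) = q] /\
  [/\ forall Y, principal_solution N S 0 Y -> backward_focal N S Y = p,
      forall Y, principal_solution N S N.+1 Y -> forward_focal N S Y = p,
      forall Y, principal_solution N S N.+1 Y -> (backward_focal N S Y)%:Z = q
    & forall Y, principal_solution N S 0 Y -> (forward_focal N S Y)%:Z = q].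
Proof.
have ia k : ind (a k - a k) = 0%N by rewrite subrr ind0.
have focal0 (x y z : nat) : x = 0%N -> (y + x = z)%N -> y = z by lia.
have focalB (x y z w : nat) : x = 0%N -> (y + w = z + x)%N -> y%:Z = z%:Z - w%:Z by lia.
exists (step + ind (a N.+1 - a 0))%N, (step%:Z - (ind (a 0 - a N.+1))%:Z).
split; first split.
- exact: mu_c_minus_chart.
- exact: mu_c_plus_chart.
- exact: nu_c_minus_chart.
- exact: nu_c_plus_chart.
split=> Y pY.
- exact: focal0 (ia 0%N) (backward_focal_chart (leq0n _) pY).
- exact: focal0 (ia N.+1) (forward_focal_chart (leqnn _) pY).
- exact: focalB (ia N.+1) (backward_focal_chart (leqnn _) pY).
- exact: focalB (ia 0%N) (forward_focal_chart (leq0n _) pY).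
Qed.

End System.

Theorem theorem4p6 (R : realType) (n N : nat) (S : nat -> 'M[R]_(n + n)) :
  symplectic_system N S ->
  (forall (Z : nat -> 'M[R]_(n + n)) (Y0 YN1 : nat -> 'M[R]_(n + n, n)),
     fundamental_matrix N S Z ->
     principal_solution N S 0 Y0 ->
     principal_solution N S N.+1 YN1 ->
     let V := fun k => invmx (Z k) *m bmx R n in
     let fwd := fun i => V i.-1 in (* for i from 1 to N+2 *)
     let bwd := fun i => V (N.+2 - i)%N in (* the same list reversed *)
     [/\ mu_c_minus N.+2 fwd = backward_focal N S Y0,
         backward_focal N S Y0 = mu_c_plus N.+2 bwd
       & mu_c_plus N.+2 bwd = forward_focal N S YN1] /\
     [/\ nu_c_minus N.+2 fwd = (backward_focal N S YN1)%:Z,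
         (backward_focal N S YN1)%:Z = nu_c_plus N.+2 bwd
       & nu_c_plus N.+2 bwd = (forward_focal N S Y0)%:Z]) /\
  (forall Z Z' : nat -> 'M[R]_(n + n),
     fundamental_matrix N S Z ->
     fundamental_matrix N S Z' ->
     let V := fun k => invmx (Z k) *m bmx R n in
     let V' := fun k => invmx (Z' k) *m bmx R n in
     [/\ mu_c_minus N.+2 (fun i => V i.-1) = mu_c_minus N.+2 (fun i => V' i.-1),
         mu_c_plus N.+2 (fun i => V (N.+2 - i)%N)
           = mu_c_plus N.+2 (fun i => V' (N.+2 - i)%N),
         nu_c_minus N.+2 (fun i => V i.-1) = nu_c_minus N.+2 (fun i => V' i.-1)
       & nu_c_plus N.+2 (fun i => V (N.+2 - i)%N)
           = nu_c_plus N.+2 (fun i => V' (N.+2 - i)%N)]).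
Proof.
move=> sS; set first := (X in X /\ _).
suff H : first.
  split; first exact: H.
  move=> Z Z' fZ fZ' V V'.
  (* The principal solutions built from [Z] serve for [Z'] as well: their focal-point numbers depend
     only on the system and link the cyclic sums of both. *)
  have p0 := principal_solution_exists fZ (leq0n N.+1).
  have p1 := principal_solution_exists fZ (leqnn N.+1).
  have [[e1 e2 e3] [e4 e5 e6]] := H Z _ _ fZ p0 p1.
  have [[e1' e2' e3'] [e4' e5' e6']] := H Z' _ _ fZ' p0 p1.
  split; first exact: etrans e1 (esym e1').
  - exact: etrans e3 (esym e3').
  - exact: etrans e4 (esym e4').
  exact: etrans e6 (esym e6').
move=> Z Y0 YN1 fZ p0 p1 V fwd bwd.
(* The bound [N.+2] gives a single [c] valid for all indices from 0 to [N.+1]. *)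
have [c uV] := chart_exists (m := N.+2) (fun k => @frame_fundamental _ _ _ _ _ fZ k).
have [p [q [[e1 e2 e3 e4] [b0 fN bN f0]]]] := focal_points_chart sS fZ uV.
split; first split.
- exact: etrans e1 (esym (b0 _ p0)).
- exact: etrans (b0 _ p0) (esym e2).
- exact: etrans e2 (esym (fN _ p1)).
split.
- exact: etrans e3 (esym (bN _ p1)).
- exact: etrans (bN _ p1) (esym e4).
exact: etrans e4 (esym (f0 _ p0)).
Qed.
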